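(* Let $r,z\ge1$ be integers. If $r>1$ or $z>1$, then there is no $(r,z,3;-1)$-graph.
   Context: A mixed graph $G$ consists of a finite vertex set $V(G)$, a set $E(G)$ of edges (unordered pairs of distinct vertices; $x\sim y$ means $\{x,y\}\in E(G)$) and a set $A(G)$ of arcs (ordered pairs of distinct vertices; $x\to y$ means $(x,y)\in A(G)$), with at most one edge or arc between any two vertices (so no two vertices are joined by both an edge and an arc, nor by arcs in both directions). The order of $G$ is $|V(G)|$. For a vertex $v$, the undirected degree is the number of $u$ with $u\sim v$ and the directed out-degree is the number of $u$ with $v\to u$. A walk of length $m$ from $u$ to $v$ is a sequence $u=v_0,\dots,v_m=v$ with $v_i\sim v_{i+1}$ or $v_i\to v_{i+1}$ for each $i<m$; a path is a walk with distinct vertices. The distance $d(u,v)$ is the length of a shortest path from $u$ to $v$ ($\infty$ if none), and the diameter of $G$ is the maximum of $d(u,v)$ over all ordered pairs of vertices. Mixed Moore bound: $M(r,z,k)=A\frac{u_1^{k+1}-1}{u_1-1}+B\frac{u_2^{k+1}-1}{u_2-1}$, where $w=(z+r)^2+2(z-r)+1$, $u_1=\frac{z+r-1-\sqrt w}{2}$, $u_2=\frac{z+r-1+\sqrt w}{2}$, $A=\frac{\sqrt w-(z+r+1)}{2\sqrt w}$, $B=\frac{\sqrt w+(z+r+1)}{2\sqrt w}$. An $(r,z,k;-\delta)$-graph is a mixed graph of diameter $k$ with maximum undirected degree $r$, maximum directed out-degree $z$ and order $M(r,z,k)-\delta$. *)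

(* Defs.v *)
From mathcomp Require Import all_boot all_order all_algebra.

Set Implicit Arguments.
Unset Strict Implicit.
Unset Printing Implicit Defensive.

Import Order.TTheory GRing.Theory Num.Theory.
Local Open Scope ring_scope.

(* The edge set, a set of unordered pairs of distinct vertices, is encoded as a
   symmetric irreflexive relation; [arc x y] stands for x -> y. *)
Record mixedGraph : Type := MixedGraph {
  vertex :> finType;
  edge : rel vertex;
  arc : rel vertex;
  edge_sym : symmetric edge;
  edge_irr : irreflexive edge;
  arc_irr : irreflexive arc;
  arc_asym : forall x y, arc x y -> ~~ arc y x;
  edge_not_arc : forall x y, edge x y -> ~~ arc x y
}.

Section MixedGraph.
Variable G : mixedGraph.
Implicit Types (u v : G) (s : seq G).

Definition step : rel G := fun x y => edge x y || arc x y.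

(* The vertices of the walk are [u :: s], so its length is [size s]. *)
Definition is_walk u v s : bool := path step u s && (last u s == v).

Definition is_path u v s : bool := is_walk u v s && uniq (u :: s).

(* [is_dist u v m] means d(u,v) = m with m finite; d(u,v) is infinite exactly
   when no m satisfies it. *)
Definition is_dist u v (m : nat) : Prop :=
  (exists2 s, is_path u v s & size s = m) /\
  (forall s, is_path u v s -> (m <= size s)%N).

(* The maximum over all ordered pairs (u,v) of d(u,v) is attained and equals
   the finite value k; in particular all distances are finite. *)
Definition has_diameter (k : nat) : Prop :=
  (forall u v, exists2 m, is_dist u v m & (m <= k)%N) /\
  (exists u v, is_dist u v k).

Definition undirected_degree v : nat := #|[set u | edge v u]|.

Definition out_degree v : nat := #|[set u | arc v u]|.

End MixedGraph.

Section MooreBound.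
Variables (R : rcfType) (r z : nat).

Definition moore_w : R := (z%:R + r%:R) ^+ 2 + 2 * (z%:R - r%:R) + 1.

Definition moore_u1 : R := (z%:R + r%:R - 1 - Num.sqrt moore_w) / 2.

Definition moore_u2 : R := (z%:R + r%:R - 1 + Num.sqrt moore_w) / 2.

Definition moore_A : R :=
  (Num.sqrt moore_w - (z%:R + r%:R + 1)) / (2 * Num.sqrt moore_w).

Definition moore_B : R :=
  (Num.sqrt moore_w + (z%:R + r%:R + 1)) / (2 * Num.sqrt moore_w).

(* For r, z >= 1 all denominators are nonzero: moore_w is
   (z + r - 1)^2 + 4z > 0, and moore_u1 or moore_u2 is 1 only if r + 2z = 2. *)
Definition moore_bound (k : nat) : R :=
  moore_A * ((moore_u1 ^+ k.+1 - 1) / (moore_u1 - 1))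
  + moore_B * ((moore_u2 ^+ k.+1 - 1) / (moore_u2 - 1)).

End MooreBound.

(* The mixed graph G is an (r, z, k; -delta)-graph. *)
Definition is_rzk_graph (R : rcfType) (r z k delta : nat) (G : mixedGraph) :
    Prop :=
  [/\ has_diameter G k,
      (\max_(v : G) undirected_degree v)%N = r,
      (\max_(v : G) out_degree v)%N = z
    & #|G|%:R = moore_bound R r z k - delta%:R].

(* Main.v *)
Require Import Defs.
From mathcomp Require Import all_boot all_order all_algebra.
From mathcomp Require Import zify ring lra.
(* Restores [Defs.arc], which [path.arc] shadows. *)
Import Defs.

Set Implicit Arguments.
Unset Strict Implicit.
Unset Printing Implicit Defensive.

(* Let d = r + z.  Every vertex has undirected degree r and out-degree z, and
   among the d^3 + d^2 + d + 1 - 2 r d nonbacktracking walks of length at most 3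
   starting at u exactly one vertex P(u), the repeat of u, is reached twice.  With
   E, A the matrices of edges and arcs and N = E + A, counting these walks reads
   N^3 + N^2 - (2r - 1) N - (r - 1) I + E = J + P.  Commuting it with N gives
   N P + E A - P N - A E = 1 e^T with e(v) = in-degree(v) - z, while E A and A E
   are 0-1 matrices with disjoint supports.
   If e(s) < 0 then P(u) -> s or P(u) ~ s for almost all u.  For almost all u two
   vertices of the u-row of A E are then repeats of out-neighbours of u, hence
   lead to s, so that two walks of length 3 from u to s make s = P(u), which is
   absurd; hence all in-degrees are z and P is a permutation.  Now
   EA(u) is contained in N(P(u)), so that r z <= r + z.  The cases r >= 2, i.e.
   z = 1 or r = z = 2, die by exhibiting second walks.  If r = 1 the same method
   yields P = E, hence N^3 + N^2 = N + J, and the irrationality of sqrt 5 is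
   incompatible with the traces of N and N^2 unless d = 2. *)

(** * Sums against indicator functions *)

Lemma sum_pred1l (T : finType) (u : T) (F : T -> nat) :
  \sum_x (u == x) * F x = F u.
Proof.
rewrite (bigD1 u) //= eqxx mul1n big1 ?addn0 // => x.
by rewrite eq_sym => /negbTE ->.
Qed.

Lemma sum_pred1r (T : finType) (u : T) (F : T -> nat) :
  \sum_x F x * (x == u) = F u.
Proof.
by rewrite -[RHS](sum_pred1l u); apply: eq_bigr => x _; rewrite mulnC eq_sym.
Qed.

Lemma sum_const (T : finType) c : \sum_(x : T) c = #|T| * c.
Proof. by rewrite sum_nat_const. Qed.

Lemma sum_neq (T : finType) (u : T) (F : T -> nat) :
  \sum_x F x * (u != x) + F u = \sum_x F x.
Proof.
rewrite -[F u in LHS](sum_pred1r u) -big_split /=; apply: eq_bigr => x _.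
by rewrite [u == x]eq_sym; case: eqVneq; lia.
Qed.

Lemma sum_gt1 (T : finType) (F : T -> nat) : (forall x, F x <= 1) ->
  1 < \sum_x F x -> exists x y, [/\ 0 < F x, 0 < F y & x != y].
Proof.
move=> F1; have -> : \sum_x F x = #|[set x | 0 < F x]|.
  rewrite -sum1_card [RHS]big_mkcond /=; apply: eq_bigr => x _; rewrite inE.
  by case: (F x) (F1 x) => [|[]].
by case/card_gt1P => x [y []]; rewrite !inE; exists x, y.
Qed.

(** * Nonbacktracking walks *)

Section NonbacktrackingWalks.
Variable G : mixedGraph.
Implicit Types (u v x y : G) (f g h : G -> G -> nat).

Definition edg u v : nat := edge u v.
Definition arw u v : nat := arc u v.
Definition stp u v : nat := step u v.

Definition comp f g u v := \sum_x f u x * g x v.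

Lemma compA f g h u v : comp f (comp g h) u v = comp (comp f g) h u v.
Proof.
rewrite /comp.
under eq_bigr do rewrite big_distrr /=.
rewrite exchange_big /=; apply: eq_bigr => x _.
by rewrite big_distrl /=; apply: eq_bigr => y _; rewrite mulnA.
Qed.

Lemma edgC u v : edg u v = edg v u.
Proof. by rewrite /edg edge_sym. Qed.

Lemma step_split u v : step u v -> edge u v \/ arc u v.
Proof. by case/orP; [left|right]. Qed.

Lemma edge_step u v : edge u v -> step u v.
Proof. by rewrite /step => ->. Qed.

Lemma arc_step u v : arc u v -> step u v.
Proof. by rewrite /step orbC => ->. Qed.

Lemma edge_neq u v : edge u v -> u != v.
Proof. by apply: contraTneq => ->; rewrite edge_irr. Qed.

Lemma arc_neq u v : arc u v -> u != v.
Proof. by apply: contraTneq => ->; rewrite arc_irr. Qed.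

Lemma step_neq u v : step u v -> u != v.
Proof. by case/step_split => [/edge_neq|/arc_neq]. Qed.

Lemma arc_not_step u v : arc u v -> ~~ step v u.
Proof.
move=> a; rewrite negb_or (arc_asym a) andbT edge_sym.
by apply: contraL a => /edge_not_arc.
Qed.

Lemma arc_not_edge u v : arc u v -> ~~ edge u v.
Proof. by apply: contraL => /edge_not_arc. Qed.

Lemma step_neq_arc u v w : step u v -> arc v w -> u != w.
Proof. by move=> s /arc_not_step; apply: contraNneq => <-. Qed.

Lemma arc_neq_step u v w : arc u v -> step v w -> u != w.
Proof. by move=> /arc_not_step a s; apply: contraNneq a => ->. Qed.

Lemma stpE u v : stp u v = edg u v + arw u v.
Proof.
rewrite /stp /edg /arw /step; case e: (edge u v) => //=.
by rewrite (negbTE (edge_not_arc e)).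
Qed.

Lemma stp_stp u v : stp u v * stp v u = edg u v.
Proof.
rewrite /stp /edg /step [edge v u]edge_sym; case e: (edge u v) => //=.
by case a: (arc u v) => //=; rewrite (negbTE (arc_asym a)).
Qed.

(* The inner vertices of a walk of length at most 3: [inl false] and [inl true]
   stand for the lengths 0 and 1. *)
Definition inner := (bool + (G + G * G))%type.

Definition nbwalk u v (t : inner) : bool :=
  match t with
  | inl false => u == v
  | inl true => step u v
  | inr (inl x) => [&& step u x, step x v & u != v]
  | inr (inr (x, y)) => [&& step u x, step x y, step y v, u != y & x != v]
  end.

Definition walks u v := #|[set t | nbwalk u v t]|.

Lemma walksE u v : walks u v =
  (u == v) + stp u v + \sum_x stp u x * stp x v * (u != v)
  + \sum_x \sum_y stp u x * stp x y * stp y v * (u != y) * (x != v).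
Proof.
rewrite /walks cardsE -sum1_card big_mkcond /= big_sumType /= big_sumType /=.
rewrite (bigD1 false) //= (bigD1 true) //= big_pred0; last by case.
rewrite addn0 /stp !unfold_in /=.
have ifE (b : bool) : (if b then 1 else 0) = b by case: b.
rewrite !ifE addnA; congr (_ + _ + _).
  by apply: eq_bigr => x _; rewrite unfold_in /= ifE !mulnb andbA.
rewrite pair_big /=; apply: eq_bigr => -[x y] _.
by rewrite unfold_in /= ifE !mulnb !andbA.
Qed.

Lemma walks_gt1 u v s t : nbwalk u v s -> nbwalk u v t -> s != t ->
  1 < walks u v.
Proof.
by move=> Hs Ht st; apply/card_gt1P; exists s, t; rewrite !inE; split.
Qed.

Lemma diam_walks u v : has_diameter G 3 -> 0 < walks u v.
Proof.
case=> /(_ u v) [m [[s /andP[/andP[ps /eqP ls] us] <-] _] sz] _.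
suff [t Ht]: exists t, nbwalk u v t.
  by apply/card_gt0P; exists t; rewrite inE.
case: s ps ls us sz => [|x [|y [|w [|]]]] //=.
- by move=> _ -> _ _; exists (inl false) => /=.
- by rewrite andbT => h <- _ _; exists (inl true).
- rewrite !inE andbT => /andP[h1 h2] <- /andP[]; rewrite negb_or => /andP[_ n] _ _.
  by exists (inr (inl x)) => /=; rewrite h1 h2 n.
- rewrite !inE andbT => /and3P[h1 h2 h3] <- /and3P[].
  rewrite !negb_or => /and3P[_ n1 _] /andP[_ n2] _ _.
  by exists (inr (inr (x, y))) => /=; rewrite h1 h2 h3 n1 n2.
Qed.

Lemma sum_edg u : \sum_v edg u v = undirected_degree u.
Proof.
rewrite /undirected_degree -sum1_card [RHS]big_mkcond /=.
by apply: eq_bigr => x _; rewrite inE /edg; case: edge.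
Qed.

Lemma sum_arw u : \sum_v arw u v = out_degree u.
Proof.
rewrite /out_degree -sum1_card [RHS]big_mkcond /=.
by apply: eq_bigr => x _; rewrite inE /arw; case: arc.
Qed.

Lemma sum_stp u : \sum_v stp u v = undirected_degree u + out_degree u.
Proof.
by rewrite -sum_edg -sum_arw -big_split; apply: eq_bigr => v _; rewrite stpE.
Qed.

Lemma sum_walks u : \sum_v walks u v =
  1 + \sum_x stp u x * (1 + \sum_y stp x y * (u != y) *
                              (1 + \sum_v stp y v * (x != v))).
Proof.
under eq_bigr do rewrite walksE.
rewrite !big_split /= -!addnA; congr (_ + _).
  rewrite -[RHS](sum_pred1l u (fun=> 1)).
  by under [RHS]eq_bigr do rewrite muln1.
under [RHS]eq_bigr do rewrite mulnDr muln1.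
rewrite big_split /=; congr (_ + _).
have -> : \sum_v \sum_x stp u x * stp x v * (u != v) =
    \sum_x stp u x * \sum_y stp x y * (u != y).
  rewrite exchange_big; apply: eq_bigr => x _; rewrite big_distrr.
  by apply: eq_bigr => y _ /=; rewrite mulnA.
rewrite exchange_big -big_split; apply: eq_bigr => x _ /=.
rewrite exchange_big !big_distrr -big_split; apply: eq_bigr => y _ /=.
rewrite mulnDr muln1 mulnDr /= mulnA; congr (_ + _).
rewrite !big_distrr /=; apply: eq_bigr => v _.
by rewrite !mulnA; congr (_ * _); rewrite mulnAC.
Qed.

(** In matrices, W = I + N + (N^2 - r I) + (N^3 - 2 r N + E). Only edges can be traversed back, so
    each of the two ways to backtrack in length 3 removes r N, and the walks u v u v, which do both,
    come back as E. *)
Lemma walks_comp r u v : (forall w : G, undirected_degree w = r) ->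
  walks u v + r * (u == v) + 2 * r * stp u v =
  (u == v) + stp u v + comp stp stp u v + comp stp (comp stp stp) u v + edg u v.
Proof.
move=> deg; rewrite walksE.
have back w : \sum_x stp w x * stp x w = r.
  by under eq_bigr do rewrite stp_stp; rewrite sum_edg deg.
have two : \sum_x stp u x * stp x v * (u != v) + r * (u == v) = comp stp stp u v.
  rewrite /comp; case: eqVneq => [<-|_] /=.
    by rewrite big1 ?back ?muln1 // => x _; rewrite muln0.
  by rewrite muln0 addn0; apply: eq_bigr => x _; rewrite muln1.
suff three : \sum_x \sum_y stp u x * stp x y * stp y v * (u != y) * (x != v)
    + 2 * r * stp u v = comp stp (comp stp stp) u v + edg u v by lia.
have -> : comp stp (comp stp stp) u v =
    \sum_x \sum_y stp u x * stp x y * stp y v.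
  apply: eq_bigr => x _; rewrite /comp big_distrr /=.
  by apply: eq_bigr => y _ /=; rewrite mulnA.
have e1 : \sum_x \sum_y stp u x * stp x y * stp y v * (y == u) = r * stp u v.
  under eq_bigr do rewrite sum_pred1r.
  by rewrite -big_distrl back.
have e2 : \sum_x \sum_y stp u x * stp x y * stp y v * (x == v) = r * stp u v.
  rewrite exchange_big /=; under eq_bigr do rewrite sum_pred1r.
  by under eq_bigr do rewrite -mulnA; rewrite -big_distrr back /= mulnC.
have e3 : \sum_x \sum_y stp u x * stp x y * stp y v * (y == u) * (x == v) =
    edg u v.
  rewrite exchange_big /=; under eq_bigr do rewrite sum_pred1r mulnAC -mulnA.
  under eq_bigr do rewrite mulnC -!mulnA.
  rewrite (eq_bigr (fun y => (stp u v * stp v u * stp u v) * (y == u))).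
    rewrite -big_distrr /=.
    have -> : \sum_i (i == u) = 1.
      by rewrite -[RHS](sum_pred1r u (fun=> 1)); apply: eq_bigr => i _; rewrite mul1n.
    by rewrite stp_stp stpE /edg /arw; case: (boolP (edge u v)) => //= /edge_not_arc/negbTE->.
  by move=> y _; case: (eqVneq y u) => [->|_]; rewrite ?muln0 ?muln1; lia.
rewrite -[2 * r]/((1 + 1) * r) mulnDl mul1n mulnDl -{1}e1 -e2 -e3 -!big_split /=.
apply: eq_bigr => x _; rewrite -!big_split /=; apply: eq_bigr => y _.
rewrite [y == u]eq_sym; case: (u == y); case: (x == v) => /=; lia.
Qed.
End NonbacktrackingWalks.
Arguments edg {G} u v.
Arguments arw {G} u v.
Arguments stp {G} u v.

(** * Out-regularity and repeats *)

Section OutRegular.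
Variables (G : mixedGraph) (r z : nat).
Hypotheses (r_gt0 : 0 < r) (z_gt0 : 0 < z).
Hypothesis diamG : has_diameter G 3.
Hypothesis deg_le : forall u : G, undirected_degree u <= r.
Hypothesis out_le : forall u : G, out_degree u <= z.
Let d := r + z.
Hypothesis cardG : #|G| + 2 * r * d = d + d ^ 2 + d ^ 3.
Implicit Types u v x y : G.

(** Entering [y] along an edge leaves at most d - 1 steps that do not return to [x]; an arc leaves
    up to d. *)
Lemma last_level_le x y : stp x y * (1 + \sum_v stp y v * (x != v)) <=
  edg x y * d + arw x y * (d + 1).
Proof.
have := sum_neq x (stp y); rewrite sum_stp => s.
have := deg_le y; have := out_le y => o a.
have := stp_stp x y; rewrite stpE.
have : edg x y + arw x y <= 1 by rewrite -stpE /stp; case: step.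
by rewrite /d; nia.
Qed.

Lemma branch_le u x :
  stp u x * (1 + \sum_y stp x y * (u != y) * (1 + \sum_v stp y v * (x != v))) <=
  edg u x * (1 + (r - 1) * d + z * (d + 1)) + arw u x * (1 + r * d + z * (d + 1)).
Proof.
have le : \sum_y stp x y * (u != y) * (1 + \sum_v stp y v * (x != v)) <=
    (undirected_degree x - edg x u) * d + z * (d + 1).
  have -> : undirected_degree x - edg x u = \sum_y edg x y * (u != y).
    by have := sum_neq u (edg x); rewrite sum_edg; lia.
  apply: (@leq_trans (\sum_y (edg x y * (u != y) * d + arw x y * (d + 1)))).
    apply: leq_sum => y _; have := last_level_le x y.
    by case: (u != y); rewrite ?muln1 ?muln0; lia.
  rewrite big_split -!big_distrl /= leq_add2l leq_mul2r sum_arw out_le.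
  by rewrite orbT.
have dx := deg_le x; move: le; rewrite stpE [edg x u]edgC => le.
have : edg u x + arw u x <= 1 by rewrite -stpE /stp; case: step.
move: le; case: (edg u x) => [|[|?]]; case: (arw u x) => [|[|?]] //= le _.
- rewrite subn0 in le.
  have : undirected_degree x * d <= r * d by rewrite leq_mul2r dx orbT.
  by lia.
- have : (undirected_degree x - 1) * d <= (r - 1) * d.
    by rewrite leq_mul2r leq_sub2r ?orbT.
  by lia.
Qed.

(** A branch opened by an edge has at most [Ce] walks, one opened by an arc at most [Ce + d], and
    full branches total #|G| + 1. A missing edge or arc costs at least [Ce], which exceeds 1, so
    that some vertex would stay unreached. *)
Lemma out_regular u : undirected_degree u = r /\ out_degree u = z.
Proof.
have n_le : #|G| <= \sum_v walks u v.
  rewrite -[#|G|]muln1 -sum_const; apply: leq_sum => v _; exact: diam_walks.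
have := leq_sum (P := xpredT) (index_enum G) (fun x _ => branch_le u x).
rewrite big_split -!big_distrl /= sum_edg sum_arw.
move: n_le; rewrite sum_walks => n_le le.
have ha := deg_le u; have ho := out_le u.
suff: ~~ ((undirected_degree u < r) || (out_degree u < z)).
  by rewrite negb_or -!leqNgt => /andP[ra zo]; split; apply/eqP; rewrite eqn_leq ?ha ?ho.
apply/negP => lt.
set Ce := 1 + (r - 1) * d + z * (d + 1) in le.
have eCa : 1 + r * d + z * (d + 1) = Ce + d.
  by rewrite /Ce; case: (r) r_gt0 => //= r' _; rewrite subn1 /=; lia.
rewrite eCa in le.
have tot : r * Ce + z * (Ce + d) = #|G|.
  have: r * Ce + z * (Ce + d) + 2 * r * d = d + d ^ 2 + d ^ 3.
    rewrite /Ce /d; case: (r) r_gt0 => //= r' _; rewrite subn1 /= !expnS expn0.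
    by ring.
  lia.
have Ce_gt1 : 1 < Ce.
  have : 0 < z * (d + 1) by rewrite muln_gt0 z_gt0 addn1.
  by rewrite /Ce -addnA add1n ltnS addn_gt0 => ->; rewrite orbT.
have : undirected_degree u * Ce + out_degree u * (Ce + d) + Ce <=
    r * Ce + z * (Ce + d).
  case/orP: lt => [lt_a|lt_o].
    have := leq_mul lt_a (leqnn Ce); have := leq_mul ho (leqnn (Ce + d)).
    by lia.
  have := leq_mul lt_o (leqnn (Ce + d)); have := leq_mul ha (leqnn Ce).
  by lia.
by lia.
Qed.

Lemma sum_walks_eq u : \sum_v walks u v = #|G| + 1.
Proof.
have deg (w : G) : undirected_degree w = r by have [] := out_regular w.
have sN (w : G) : \sum_v stp w v = d by rewrite sum_stp; have [-> ->] := out_regular w.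
have sC (f : G -> G -> nat) k w : (forall x, \sum_v f x v = k) ->
    \sum_v comp stp f w v = d * k.
  move=> fk; rewrite exchange_big /=.
  under eq_bigr do rewrite -big_distrr fk /=.
  by rewrite -big_distrl /= sN.
have s1 : \sum_v (u == v) = 1.
  by rewrite -[RHS](sum_pred1l u (fun=> 1)); apply: eq_bigr => v _; rewrite muln1.
have : \sum_v (walks u v + r * (u == v) + 2 * r * stp u v) =
    \sum_v ((u == v) + stp u v + comp stp stp u v +
      comp stp (comp stp stp) u v + edg u v).
  by apply: eq_bigr => v _; exact: walks_comp.
rewrite !big_split /= -!big_distrr /= !s1 !sN sum_edg deg.
rewrite (sC _ d) // (sC _ (d * d)); last by move=> x; rewrite (sC _ d).
move: cardG; rewrite !expnS expn0 !muln1.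
move: #|G| (\sum_v _) (d * d) (d * (d * d)) (2 * r * d) => n S a b c e.
lia.
Qed.

(** The counts are positive and sum to #|G| + 1, so a single one of them exceeds 1, and it is 2. *)
Lemma repeat_exists u : {p : G | forall v, walks u v = 1 + (v == p)}.
Proof.
suff /sigW[p /forallP h] : exists p : G, [forall v, walks u v == 1 + (v == p)].
  by exists p => v; apply/eqP.
have pos v : 0 < walks u v by exact: diam_walks.
have s1 : \sum_v (walks u v - 1) = 1.
  have := sum_walks_eq u.
  rewrite (eq_bigr (fun v => (walks u v - 1) + 1)); last by move=> v _; rewrite subnK.
  by rewrite big_split /= sum_const muln1 addnC => /addnI.
have [p _ hp] : exists2 p, p \in G & 0 < walks u p - 1.
  apply/exists_inP; apply: contraPT s1; rewrite negb_exists => /forallP h.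
  by rewrite big1 // => v _; have := h v; rewrite inE /=; lia.
exists p; apply/forallP => v; move: s1; rewrite (bigD1 p) //=.
case: (eqVneq v p) => [->|vp]; first by have := pos p; lia.
by rewrite (bigD1 v) //=; have := pos v; lia.
Qed.

End OutRegular.

(** * In-regularity *)

(* [E] will be the total in-degree deficit. *)
Lemma deficit_arith n r z E : 0 < r -> 0 < z -> 1 < r * z ->
  n + 2 * r * (r + z) = (r + z) + (r + z) ^ 2 + (r + z) ^ 3 ->
  n * E <= n * (r + (1 < z) * z) + r * (z + 1) * E ->
  n <= r * (z + 1) * E + ((r + z) * (r * z + E) + E) + (r + z - 1) -> False.
Proof.
move=> r0 z0 rz eqn le1 le2.
have [z1|z1] := leqP z 1.
  have ez : z = 1 by lia.
  subst z; rewrite ltnn mul0n addn0 muln1 in le1 rz le2.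
  have [k ek] : exists k, r = k + 2 by exists (r - 2); lia.
  subst r; clear r0 z0 z1 rz.
  have en : n = (k + 3) * ((k + 2) * (k + 2) + k + 5) by nia.
  (* [le1] forces E <= r; then [le2] bounds the cubic [n] by a quadratic in r that lies below it for
     r >= 2. *)
  have : E <= k + 2.
    rewrite leqNgt; apply/negP => lt.
    have [j ej] : exists j, E = j + k + 3 by exists (E - (k + 3)); lia.
    subst E; nia.
  nia.
rewrite z1 mul1n in le1.
have [a ea] : exists a, r = a + 1 by exists (r - 1); lia.
have [b eb] : exists b, z = b + 2 by exists (z - 2); lia.
subst r z; clear r0 z0 z1 rz.
have en : n = a * a * a + b * b * b + 3 * (a * a * b) + 3 * (a * b * b)
    + 8 * (a * a) + 10 * (b * b) + 18 * (a * b) + 26 * a + 32 * b + 33.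
  by move: eqn; rewrite !expnS expn0 !muln1; lia.
have ec : (a + 1) * (b + 2 + 1) = a * b + 3 * a + b + 3 by lia.
have ez : (a + 1) * (b + 2) = a * b + 2 * a + b + 2 by lia.
have er : a + 1 + (b + 2) = a + b + 3 by lia.
rewrite ec ez er in le1 le2; clear eqn.
set c := a * b + 3 * a + b + 3 in le1 le2.
have dE : E <= a + b + 3.
  rewrite leqNgt; apply/negP => lt.
  have [j ej] : exists j, E = j + (a + b + 4) by exists (E - (a + b + 4)); lia.
  have h1 : (a + b + 4) * c < n by rewrite en /c; lia.
  have h2 : c * j <= n * j by rewrite leq_mul2r en /c; lia.
  rewrite ej in le1; move: le1 h1 h2; clearbody c; clear; lia.
have h1 : c * E <= c * (a + b + 3) by rewrite leq_mul2l dE orbT.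
have h2 : (a + b + 3) * E <= (a + b + 3) * (a + b + 3) by rewrite leq_mul2l dE orbT.
have sq : a <= a * a by rewrite -{1}[a]muln1; case: (a) => // k; rewrite leq_mul2l.
by move: h1; rewrite /c => h1; lia.
Qed.

Section AlmostMoore.
Variables (G : mixedGraph) (r z : nat) (P : G -> G).
Hypotheses (r_gt0 : 0 < r) (z_gt0 : 0 < z).
Hypothesis degG : forall u : G, undirected_degree u = r.
Hypothesis outG : forall u : G, out_degree u = z.
Hypothesis walksP : forall u v, walks u v = 1 + (v == P u).
Implicit Types u v w x y : G.

Lemma repeatP u v s t : nbwalk u v s -> nbwalk u v t -> s != t -> v = P u.
Proof.
move=> Hs Ht st; have := walks_gt1 Hs Ht st.
by rewrite walksP; case: eqP.
Qed.

Lemma reach u v : exists t, nbwalk u v t.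
Proof.
have : 0 < walks u v by rewrite walksP.
by case/card_gt0P => t; rewrite inE; exists t.
Qed.

Definition in_degree v := \sum_u arw u v.

Lemma sum_edgl v : \sum_u edg u v = r.
Proof. by under eq_bigr do rewrite edgC; rewrite sum_edg degG. Qed.

Lemma sum_stpl v : \sum_u stp u v = r + in_degree v.
Proof.
by under eq_bigr do rewrite stpE; rewrite big_split /= sum_edgl.
Qed.

Lemma comp_ge1 (f g : G -> G -> nat) u x v : 0 < f u x -> 0 < g x v ->
  0 < comp f g u v.
Proof.
by move=> hf hg; rewrite /comp (bigD1 x) //= addn_gt0 muln_gt0 hf hg.
Qed.

Lemma comp_gt0 (f g : G -> G -> nat) u v : 0 < comp f g u v ->
  exists x, 0 < f u x /\ 0 < g x v.
Proof.
rewrite /comp lt0n sum_nat_eq0 negb_forall => /existsP[x].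
by rewrite implyTb -lt0n muln_gt0 => /andP[]; exists x.
Qed.

(** Multiply [walks_comp] by N on either side. The powers of N and the term E E cancel, while W = J
    + P contributes the row sum r + z on one side and the column sum r + [in_degree v] on the
    other. *)
Lemma commutation u v :
  z + comp stp (fun x y => y == P x) u v + comp edg arw u v =
  in_degree v + stp (P u) v + comp arw edg u v.
Proof.
have left : comp stp (fun x y => walks x y) u v + r * stp u v
      + 2 * r * comp stp stp u v =
    stp u v + comp stp stp u v + comp stp (comp stp stp) u v
      + comp stp (comp stp (comp stp stp)) u v + comp stp edg u v.
  have -> : r * stp u v = \sum_x stp u x * (r * (x == v)).
    rewrite -[in LHS](sum_pred1r v) big_distrr; apply: eq_bigr => x _ /=.
    by rewrite mulnCA.
  have -> : 2 * r * comp stp stp u v = \sum_x stp u x * (2 * r * stp x v).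
    by rewrite big_distrr; apply: eq_bigr => x _ /=; rewrite mulnCA.
  rewrite -{1}[stp u v](sum_pred1r v) -!big_split /=.
  by apply: eq_bigr => x _; rewrite -!mulnDr walks_comp.
have right : comp (fun x y => walks x y) stp u v + r * stp u v
      + 2 * r * comp stp stp u v =
    stp u v + comp stp stp u v + comp stp (comp stp stp) u v
      + comp stp (comp stp (comp stp stp)) u v + comp edg stp u v.
  have -> : comp stp (comp stp (comp stp stp)) u v =
      comp (comp stp (comp stp stp)) stp u v.
    by rewrite -compA; apply: eq_bigr => x _; rewrite compA.
  rewrite [comp stp (comp stp stp) u v]compA.
  have -> : r * stp u v = \sum_x (r * (u == x)) * stp x v.
    rewrite -[in LHS](sum_pred1l u (stp^~ v)) big_distrr.
    by apply: eq_bigr => x _ /=; rewrite mulnA.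
  have -> : 2 * r * comp stp stp u v = \sum_x (2 * r * stp u x) * stp x v.
    by rewrite big_distrr; apply: eq_bigr => x _ /=; rewrite mulnA.
  rewrite -{1}[stp u v](sum_pred1l u (stp^~ v)) -!big_split /=.
  by apply: eq_bigr => x _; rewrite -!mulnDl walks_comp.
have e1 : comp stp (fun x y => walks x y) u v =
    r + z + comp stp (fun x y => y == P x) u v.
  rewrite -(degG u) -(outG u) -sum_stp -big_split; apply: eq_bigr => x _ /=.
  by rewrite walksP mulnDr muln1.
have e2 : comp (fun x y => walks x y) stp u v = r + in_degree v + stp (P u) v.
  rewrite -sum_stpl -(sum_pred1l (P u) (stp^~ v)) -big_split.
  by apply: eq_bigr => x _ /=; rewrite walksP mulnDl mul1n eq_sym.
have e3 : comp stp edg u v = comp edg edg u v + comp arw edg u v.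
  by rewrite -big_split; apply: eq_bigr => x _ /=; rewrite stpE mulnDl.
have e4 : comp edg stp u v = comp edg edg u v + comp edg arw u v.
  by rewrite -big_split; apply: eq_bigr => x _ /=; rewrite stpE mulnDr.
lia.
Qed.

Lemma edg_gt0 u v : (0 < edg u v) = edge u v.
Proof. by rewrite /edg lt0b. Qed.
Lemma arw_gt0 u v : (0 < arw u v) = arc u v.
Proof. by rewrite /arw lt0b. Qed.
Lemma stp_gt0 u v : (0 < stp u v) = step u v.
Proof. by rewrite /stp lt0b. Qed.

Lemma out_arc u : exists v, arc u v.
Proof.
have : 0 < #|[set v | arc u v]| by rewrite -/(out_degree u) outG.
by case/card_gt0P => v; rewrite inE; exists v.
Qed.

Lemma out_edge u : exists v, edge u v.
Proof.
have : 0 < #|[set v | edge u v]| by rewrite -/(undirected_degree u) degG.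
by case/card_gt0P => v; rewrite inE; exists v.
Qed.

(* A second walk of length 2 could be prolonged by an arc. *)
Lemma middle_unique u v x y : u != v ->
  step u x -> step x v -> step u y -> step y v -> x = y.
Proof.
move=> uv ux xv uy yv; apply/eqP; apply: contraT => xy.
have vP : v = P u.
  by apply: (@repeatP u v (inr (inl x)) (inr (inl y))) => //=; rewrite ?ux ?uy ?xv ?yv.
have [w vw] := out_arc v.
suff wP : w = P u by have := arc_neq vw; rewrite wP -vP eqxx.
apply: (@repeatP u w (inr (inr (x, v))) (inr (inr (y, v)))) => /=.
- by rewrite ux xv arc_step // uv (step_neq_arc xv vw).
- by rewrite uy yv arc_step // uv (step_neq_arc yv vw).
- by apply: contraNneq xy => -[->].
Qed.

Lemma edge_arc_neq u x v : edge u x -> arc x v -> u != v.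
Proof. by move=> /edge_step; apply: step_neq_arc. Qed.

Lemma arc_edge_neq u x v : arc u x -> edge x v -> u != v.
Proof. by move=> a /edge_step; apply: arc_neq_step. Qed.

Lemma comp_le1 (f g : G -> G -> nat) u v : (forall x y, f x y <= 1) ->
  (forall x y, g x y <= 1) ->
  (forall x y, 0 < f u x -> 0 < g x v -> 0 < f u y -> 0 < g y v -> x = y) ->
  comp f g u v <= 1.
Proof.
move=> f1 g1 inj; case: (posnP (comp f g u v)) => [-> //|/comp_gt0[x [fx gx]]].
rewrite /comp (bigD1 x) //= big1 ?addn0.
  by have := f1 u x; have := g1 x v; nia.
move=> y yx; apply/eqP; rewrite muln_eq0; apply: contraNT yx.
rewrite negb_or -!lt0n => /andP[fy gy]; apply/eqP; exact: inj.
Qed.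

Lemma edg_le1 u v : edg u v <= 1. Proof. by rewrite leq_b1. Qed.
Lemma arw_le1 u v : arw u v <= 1. Proof. by rewrite leq_b1. Qed.

(** By [middle_unique] two contributions would share their middle vertex; if they are of different
    kinds, it would be joined to [u] by both an edge and an arc. *)
Lemma edge_arc_le1 u v : comp edg arw u v + comp arw edg u v <= 1.
Proof.
have ea : comp edg arw u v <= 1.
  apply: comp_le1 => [||x y]; [exact: edg_le1 | exact: arw_le1|].
  rewrite !edg_gt0 !arw_gt0 => ux xv uy yv.
  apply: (@middle_unique u v); rewrite ?(edge_arc_neq ux xv) //;
    by [exact: edge_step | exact: arc_step].
have ae : comp arw edg u v <= 1.
  apply: comp_le1 => [||x y]; [exact: arw_le1 | exact: edg_le1|].
  rewrite !edg_gt0 !arw_gt0 => ux xv uy yv.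
  apply: (@middle_unique u v); rewrite ?(arc_edge_neq ux xv) //;
    by [exact: edge_step | exact: arc_step].
case: (posnP (comp edg arw u v)) => [->|/comp_gt0[x []]]; first by [].
rewrite edg_gt0 arw_gt0 => ux xv.
case: (posnP (comp arw edg u v)) => [->|/comp_gt0[y []]]; first by rewrite addn0.
rewrite edg_gt0 arw_gt0 => uy yv.
suff xy : x = y by have := edge_not_arc ux; rewrite xy uy.
apply: (@middle_unique u v); rewrite ?(edge_arc_neq ux xv) //;
    by [exact: edge_step | exact: arc_step].
Qed.

Lemma sum_edg_arw u : \sum_v comp edg arw u v = r * z.
Proof.
rewrite exchange_big /=; under eq_bigr do rewrite -big_distrr sum_arw outG /=.
by rewrite -big_distrl /= sum_edg degG.
Qed.

Lemma sum_arw_edg u : \sum_v comp arw edg u v = r * z.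
Proof.
rewrite exchange_big /=; under eq_bigr do rewrite -big_distrr sum_edg degG /=.
by rewrite -big_distrl /= sum_arw outG mulnC.
Qed.

Section InRegular.
Hypothesis rz_gt1 : 1 < r * z.
Hypothesis cardG : #|G| + 2 * r * (r + z) = (r + z) + (r + z) ^ 2 + (r + z) ^ 3.

Lemma arw_edg_pair u : exists x y,
  [/\ 0 < comp arw edg u x, 0 < comp arw edg u y & x != y].
Proof.
apply: sum_gt1; last by rewrite sum_arw_edg.
by move=> v; have := edge_arc_le1 u v; lia.
Qed.

Lemma deficit_le u s : z - in_degree s <= stp (P u) s + comp arw edg u s.
Proof. by have := commutation u s; lia. Qed.

(* Every vertex of [AE(u)] is a repeat of an out-neighbour of [u], and these
   repeats all lead to [s]; two of them make [s] itself the repeat of [u]. *)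
Lemma no_deficit_at s u : in_degree s < z ->
  (forall s', in_degree s' < z -> comp arw edg u s' = 0) ->
  comp stp (comp arw edg) u s = 0 -> stp u s = 0 -> False.
Proof.
move=> ds uS uTs us0.
(* By [uTs] the AE term of [deficit_le] vanishes at [w], so only a step from [P w] can account for
   the deficit of [s]. *)
have outS w : step u w -> step (P w) s.
  rewrite -!stp_gt0 => uw; have := deficit_le w s.
  case: (posnP (comp arw edg w s)) => [->|ws]; first by lia.
  by have := comp_ge1 uw ws; rewrite uTs.
have far x : 0 < comp arw edg u x -> exists b, [/\ arc u b, edge b x & step x s].
  move=> ux; have [b []] := comp_gt0 ux; rewrite arw_gt0 edg_gt0 => ub bx.
  exists b; split=> //.
  (* [x] is not deficient, and its entry in AE excludes one in EA, so the commutation identity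
     forces a positive entry of NP at [x]. *)
  have : ~~ (in_degree x < z) by apply: contraTN ux => /uS ->.
  have := commutation u x; have := edge_arc_le1 u x => h1 h2 h3.
  have /comp_gt0[w [uw]] : 0 < comp stp (fun x y => y == P x) u x by lia.
  by rewrite lt0b => /eqP ->; apply: outS; rewrite -stp_gt0.
have [x [y [ux uy xy]]] := arw_edg_pair u.
have [b [ub bx xs]] := far x ux; have [c [uc cy ys]] := far y uy.
have neq_s w : arc u w -> w != s.
  by move=> /arc_step; rewrite -stp_gt0; apply: contraTneq => ->; rewrite us0.
suff sP : s = P u.
  have := deficit_le u s; rewrite -sP uS // addn0.
  have /negbTE : ~~ step s s by apply/negP => /step_neq; rewrite eqxx.
  by rewrite -stp_gt0; lia.
apply: (@repeatP u s (inr (inr (b, x))) (inr (inr (c, y)))) => /=.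
- by rewrite arc_step // edge_step // xs (arc_edge_neq ub bx) neq_s.
- by rewrite arc_step // edge_step // ys (arc_edge_neq uc cy) neq_s.
- by apply: contraNneq xy => -[_ ->].
Qed.

(** * Double counting of in-degree deficits *)

Let deficit v := z - in_degree v.
Let excess v := in_degree v - z.
Let E := \sum_v deficit v.

Lemma sum_in_degree : \sum_v in_degree v = #|G| * z.
Proof.
rewrite exchange_big /= -sum_const; apply: eq_bigr => u _.
by rewrite sum_arw outG.
Qed.

Lemma sum_excess : \sum_v excess v = E.
Proof.
apply: (@addnI (#|G| * z)); rewrite -{2}sum_in_degree -sum_const -!big_split /=.
by apply: eq_bigr => v _; rewrite /excess /deficit; lia.
Qed.

(** An in-degree is at most [z] plus the excess, and the excesses sum to [E] because the in-degrees
    average to [z]. *)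
Lemma sum_excess_le (F : G -> nat) k : (forall w, F w <= k) ->
  \sum_w in_degree w * F w <= z * (\sum_w F w) + E * k.
Proof.
move=> Fk; rewrite -sum_excess big_distrr big_distrl -big_split /=.
apply: leq_sum => w _; have := Fk w; rewrite /excess => h.
have [le|lt] := leqP (in_degree w) z.
  by have := leq_mul le (leqnn (F w)); lia.
have -> : in_degree w = z + (in_degree w - z) by lia.
by rewrite mulnDl leq_add2l addKn leq_mul2l h orbT.
Qed.

Lemma sum_in_branch v : \sum_u comp arw edg u v = \sum_w in_degree w * edg w v.
Proof.
by rewrite exchange_big; apply: eq_bigr => w _; rewrite -big_distrl.
Qed.

Lemma sum_deficient_le : \sum_(s | in_degree s < z) 1 <= E.
Proof.
rewrite big_mkcond; apply: leq_sum => s _; rewrite /deficit.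
by case: ifP => //; lia.
Qed.

(** At most [E] vertices are deficient, each with [r] edge-neighbours; counting the in-degrees of
    these as [z] errs by at most [E * r] in total. *)
Lemma sum_in_branch_deficient :
  \sum_(s | in_degree s < z) \sum_u comp arw edg u s <= r * (z + 1) * E.
Proof.
have -> : \sum_(s | in_degree s < z) \sum_u comp arw edg u s =
    \sum_w in_degree w * \sum_(s | in_degree s < z) edg w s.
  under eq_bigr do rewrite sum_in_branch.
  by rewrite exchange_big; apply: eq_bigr => w _; rewrite big_distrr.
apply: (leq_trans (@sum_excess_le _ r _)) => [w|].
  by rewrite -(degG w) -sum_edg [leqRHS](bigID (fun s => in_degree s < z)) leq_addr.
have -> : \sum_w \sum_(s | in_degree s < z) edg w s =
    (\sum_(s | in_degree s < z) 1) * r.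
  rewrite exchange_big big_distrl; apply: eq_bigr => s _.
  by rewrite /= sum_edgl mul1n.
move: sum_deficient_le; move: (\sum_(_ | _) _) => k kE.
have -> : z * (k * r) = (r * z) * k by lia.
have -> : r * (z + 1) * E = (r * z) * E + E * r by lia.
by rewrite leq_add2r leq_mul2l kE orbT.
Qed.

Lemma sum_out_deficient p :
  \sum_(s | in_degree s < z) stp p s <= r + (1 < z) * z.
Proof.
have sub (F : G -> nat) : \sum_(s | in_degree s < z) F s <= \sum_s F s.
  by rewrite [leqRHS](bigID (fun s => in_degree s < z)) leq_addr.
under eq_bigr do rewrite stpE; rewrite big_split /=; apply: leq_add.
  by rewrite -(degG p) -sum_edg sub.
case: (ltnP 1 z) => z1; first by rewrite mul1n (leq_trans (sub _)) ?sum_arw ?outG.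
(* For z = 1 a deficient vertex has in-degree 0 and receives no arc. *)
rewrite big1 // => s ds; have : arw p s <= in_degree s.
  by rewrite /in_degree (bigD1 p) //= leq_addr.
by lia.
Qed.

Lemma deficit_total : #|G| * E <= #|G| * (r + (1 < z) * z) + r * (z + 1) * E.
Proof.
have EE : E = \sum_(s | in_degree s < z) deficit s.
  rewrite [RHS]big_mkcond; apply: eq_bigr => s _; rewrite /deficit.
  by case: ltnP => //; lia.
apply: (leq_trans _ (leq_add (leqnn _) sum_in_branch_deficient)).
rewrite -!sum_const [X in _ <= _ + X]exchange_big -big_split; apply: leq_sum => u _ /=.
rewrite EE; apply: (leq_trans _ (leq_add (sum_out_deficient (P u)) (leqnn _))).
by rewrite -big_split; apply: leq_sum => s _ /=; exact: deficit_le.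
Qed.

(** By [no_deficit_at] every [u] violates one of its three vanishing conditions; the three summands
    bound the numbers of violating [u]. *)
Lemma card_le_of_deficit s : in_degree s < z ->
  #|G| <= r * (z + 1) * E + ((r + z) * (r * z + E) + E) + (r + z - 1).
Proof.
move=> ds.
have AE_le : \sum_u comp arw edg u s <= r * z + E.
  rewrite sum_in_branch; apply: leq_trans (@sum_excess_le _ 1 _) _ => [w|].
    exact: edg_le1.
  by rewrite sum_edgl muln1 mulnC.
have tri : \sum_u comp stp (comp arw edg) u s <= (r + z) * (r * z + E) + E.
  rewrite exchange_big /=; under eq_bigr do rewrite -big_distrl /= sum_stpl mulnDl.
  rewrite big_split -big_distrr /= mulnDl -addnA leq_add //.
    by rewrite leq_mul2l AE_le orbT.
  apply: leq_trans (@sum_excess_le _ 1 _) _ => [w|].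
    by have := edge_arc_le1 w s; lia.
  by rewrite muln1 leq_add2r leq_mul2l AE_le orbT.
have near : \sum_u stp u s <= r + z - 1 by rewrite sum_stpl; lia.
apply: (leq_trans _ (leq_add (leq_add sum_in_branch_deficient tri) near)).
rewrite exchange_big -!big_split -[leqLHS]muln1 -sum_const; apply: leq_sum => u _ /=.
rewrite lt0n !addn_eq0; apply/negP => /andP[/andP[]].
rewrite sum_nat_eq0 => /forallP uS /eqP uT /eqP us.
apply: (no_deficit_at ds _ uT us) => s' ds'.
by apply/eqP; have /implyP := uS s'; apply.
Qed.

Lemma in_regular v : in_degree v = z.
Proof.
have no_deficit w : ~~ (in_degree w < z).
  apply/negP => dw; apply: (@deficit_arith #|G| r z E) => //.
  - exact: deficit_total.
  - exact: card_le_of_deficit dw.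
have E0 : E = 0.
  by rewrite /E big1 // => w _; have := no_deficit w; rewrite /deficit; lia.
have := sum_excess; rewrite E0 => /eqP; rewrite sum_nat_eq0 => /forallP/(_ v).
by have := no_deficit v; rewrite /excess /=; lia.
Qed.

(** * Repeats in the regular case *)

Lemma repeat_inj : injective P.
Proof.
have sC (f : G -> G -> nat) k v : (forall w, \sum_u f u w = k) ->
    \sum_u comp f stp u v = (r + z) * k.
  move=> fk; rewrite exchange_big /=.
  under eq_bigr do rewrite -big_distrl fk /=.
  by rewrite -big_distrr /= sum_stpl in_regular mulnC.
have sN v : \sum_u stp u v = r + z by rewrite sum_stpl in_regular.
(* Every column of P must sum to 1. With in-degrees [z] the column sums in [walks_comp] equal the
   row sums, so each column of W totals #|G| + 1. *)
suff one v : \sum_u (v == P u) = 1.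
  move=> u w Puw; apply/eqP; apply: contraT => uw.
  have := one (P u); rewrite (bigD1 u) //= eqxx (bigD1 w) 1?eq_sym //= Puw eqxx.
  by lia.
have s1 : \sum_u (u == v) = 1.
  rewrite -[RHS](sum_pred1r v (fun=> 1)).
  by apply: eq_bigr => u _; rewrite mul1n.
have : \sum_u (walks u v + r * (u == v) + 2 * r * stp u v) =
    \sum_u ((u == v) + stp u v + comp stp stp u v +
      comp (comp stp stp) stp u v + edg u v).
  by apply: eq_bigr => u _; rewrite -compA; exact: walks_comp.
rewrite !big_split /= -!big_distrr /= !s1 !sN sum_edgl.
under eq_bigr do rewrite walksP.
rewrite big_split /= sum_const (sC _ (r + z)) //.
rewrite (sC _ ((r + z) * (r + z))) => [|w]; last by rewrite (sC _ (r + z)).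
move: cardG; rewrite !expnS expn0 !muln1.
move: #|G| (\sum_v _) (r + z) => n S d e.
by move: (d * d) (d * (d * d)) e => a b e; lia.
Qed.

(** Commutation now reads NP + EA = PN + AE. As EA and AE have disjoint supports, PN covers EA, and
    NP covers AE in the next lemma. *)
Lemma edge_arc_repeat u a y : edge u a -> arc a y -> step (P u) y.
Proof.
move=> ua ay; have := commutation u y; have := edge_arc_le1 u y.
have : 0 < comp edg arw u y by apply: (@comp_ge1 _ _ u a); rewrite ?edg_gt0 ?arw_gt0.
by rewrite in_regular -stp_gt0; lia.
Qed.

Lemma arc_edge_repeat u b x : arc u b -> edge b x -> exists2 w, step u w & x = P w.
Proof.
move=> ub bx; have := commutation u x; have := edge_arc_le1 u x.
have : 0 < comp arw edg u x by apply: (@comp_ge1 _ _ u b); rewrite ?edg_gt0 ?arw_gt0.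
rewrite in_regular => h1 h2 h3.
have /comp_gt0[w [uw]] : 0 < comp stp (fun x y => y == P x) u x by lia.
by rewrite lt0b => /eqP ->; exists w; rewrite -?stp_gt0.
Qed.

Lemma other_edge_arc u x : exists a y, [/\ edge u a, arc a y & y != x].
Proof.
have [v||y [w [/comp_gt0[a [ua ay]] /comp_gt0[b [ub bw]] yw]]] :=
    @sum_gt1 _ (comp edg arw u).
- by have := edge_arc_le1 u v; lia.
- by rewrite sum_edg_arw.
rewrite !edg_gt0 !arw_gt0 in ua ay ub bw.
have [ex|] := eqVneq y x; last by exists a, y.
by exists b, w; rewrite -ex eq_sym.
Qed.

Lemma other_edge u p : 1 < r -> exists2 a, edge u a & a != p.
Proof.
rewrite -(degG u) => /card_gt1P[a [b []]]; rewrite !inE => ua ub ab.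
have [ea|] := eqVneq a p; last by exists a.
by exists b; rewrite // -ea eq_sym.
Qed.

Lemma two_arcs u : 1 < z -> exists a b, [/\ arc u a, arc u b & a != b].
Proof.
by rewrite -(outG u) => /card_gt1P[a [b []]]; rewrite !inE; exists a, b.
Qed.

(** Otherwise take u ~ a -> y with a distinct from P u. As y is also reached through P u, it is the
    repeat, and P u would have a loop. *)
Lemma repeat_not_edge u : 1 < r -> ~~ edge u (P u).
Proof.
move=> r1; apply/negP => uP; have [a ua aP] := other_edge u (P u) r1.
have [y ay] := out_arc a; have Py := edge_arc_repeat ua ay.
suff yP : y = P u by have := step_neq Py; rewrite yP eqxx.
apply: (@repeatP u y (inr (inl (P u))) (inr (inl a))) => /=.
- by rewrite edge_step // Py (edge_arc_neq ua ay).
- by rewrite edge_step // arc_step // (edge_arc_neq ua ay).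
- by apply: contraNneq aP => -[->].
Qed.

(** A shorter walk to P u extends by a step to some y with u ~ a -> y. This second walk to y gives y
    = P u, hence a loop. *)
Lemma repeat_far u t : ~~ edge u (P u) -> nbwalk u (P u) t ->
  exists x y, t = inr (inr (x, y)).
Proof.
have ne a : ~~ edge u (P u) -> edge u a -> P u != a by move=> n; apply: contraTneq => <-.
have loop y : step (P u) y -> y = P u -> False.
  by move=> /step_neq; rewrite eq_sym => /eqP.
move=> nP; case: t => [[]|[x|[x y]]] /=; last by exists x, y.
- move=> uP; have [a [y [ua ay _]]] := other_edge_arc u u.
  have Py := edge_arc_repeat ua ay; case: (loop y Py).
  apply: (@repeatP u y (inr (inl (P u))) (inr (inl a))) => /=.
  + by rewrite uP Py (edge_arc_neq ua ay).
  + by rewrite edge_step // arc_step // (edge_arc_neq ua ay).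
  + by apply: contraNneq (ne a nP ua) => -[->].
- move=> /eqP uP; have [a [y [ua ay _]]] := other_edge_arc u u.
  have Py := edge_arc_repeat ua ay; case: (loop y Py).
  apply: (@repeatP u y (inl true) (inr (inl a))) => //=.
  + by rewrite {1}uP.
  + by rewrite edge_step // arc_step // (edge_arc_neq ua ay).
(* Taking y distinct from [x] keeps the extended walk nonbacktracking. *)
- move=> /and3P[ux xP uP]; have [a [y [ua ay yx]]] := other_edge_arc u x.
  have Py := edge_arc_repeat ua ay; case: (loop y Py).
  apply: (@repeatP u y (inr (inr (x, P u))) (inr (inl a))) => //=.
  + by rewrite ux xP Py uP eq_sym yx.
  + by rewrite edge_step // arc_step // (edge_arc_neq ua ay).
Qed.

Lemma edge_arc_le_step u v : comp edg arw u v <= stp (P u) v.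
Proof.
by have := commutation u v; have := edge_arc_le1 u v; rewrite in_regular; lia.
Qed.

Lemma prod_le_sum u : r * z <= r + z.
Proof.
rewrite -(sum_edg_arw u) -{1}(degG (P u)) -{1}(outG (P u)) -sum_stp.
by apply: leq_sum => v _; exact: edge_arc_le_step.
Qed.

(** Equality gives EA = PN, hence NP = AE. For u -> b there is then u -> c ~ P b with c distinct
    from b, and c in N(P b) = EA(b) gives b ~ e -> c. So c is the repeat of u although u -> c,
    against [repeat_far]. *)
Lemma prod_degrees_neq_sum u : 1 < r -> r * z = r + z -> False.
Proof.
move=> r1 rzE.
have eqS w v : comp edg arw w v = stp (P w) v.
  apply/eqP; move: v; apply/forallP; apply: contraT; rewrite negb_forall.
  case/existsP => v nv; suff: r * z < r + z by rewrite rzE ltnn.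
  rewrite -(sum_edg_arw w) -(degG (P w)) -(outG (P w)) -sum_stp.
  rewrite (bigD1 v) // [X in _ < X](bigD1 v) //= -addSn leq_add //.
    by rewrite ltn_neqAle nv edge_arc_le_step.
  by apply: leq_sum => x _; exact: edge_arc_le_step.
have [b ub] := out_arc u.
have : 0 < comp stp (fun x y => y == P x) u (P b).
  by apply: (@comp_ge1 _ _ u b); rewrite ?stp_gt0 ?arc_step ?eqxx.
have := commutation u (P b); rewrite in_regular eqS => h1 h2.
have /comp_gt0[c []] : 0 < comp arw edg u (P b) by lia.
rewrite arw_gt0 edg_gt0 => uc cPb.
have bc : b != c by apply: contraTneq cPb => <-; exact: repeat_not_edge.
have /comp_gt0[e []] : 0 < comp edg arw b c.
  by rewrite eqS stp_gt0 edge_step // edge_sym.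
rewrite edg_gt0 arw_gt0 => be ec.
have cP : c = P u.
  apply: (@repeatP u c (inr (inr (b, e))) (inl true)) => //=.
    by rewrite (arc_step ub) (edge_step be) (arc_step ec) (arc_edge_neq ub be).
  exact: arc_step.
have [] := @repeat_far u (inl true) (repeat_not_edge u r1).
  by rewrite /= -cP arc_step.
by move=> x [].
Qed.

(** * The case z = 1, r > 1 *)

Lemma arc_unique u b c : z = 1 -> arc u b -> arc u c -> b = c.
Proof.
move=> z1 ub uc; apply/eqP; apply: contraT => bc.
suff: 1 < out_degree u by rewrite outG z1.
by apply/card_gt1P; exists b, c; rewrite !inE.
Qed.

Lemma arc_unique_l u w v : z = 1 -> arc u v -> arc w v -> u = w.
Proof.
move=> z1 uv wv; apply/eqP; apply: contraT => uw.
have := in_regular v; rewrite /in_degree (bigD1 u) // (bigD1 w) 1?eq_sym //= /arw.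
by rewrite uv wv; lia.
Qed.

(* When z = 1 the repeats of the edge-neighbours of [u] are exactly the
   edge-neighbours of the out-neighbour of [u]. *)
Lemma edge_repeat u a b : z = 1 -> 1 < r -> edge u a -> arc u b -> edge b (P a).
Proof.
move=> z1 r1 ua ub.
have sub : [set x | edge b x] \subset P @: [set x | edge u x].
  apply/subsetP => x; rewrite inE => bx.
  have [w /step_split[uw ->|uw xw]] := arc_edge_repeat ub bx.
    by apply: imset_f; rewrite inE.
  by have := repeat_not_edge b r1; rewrite {2}(arc_unique z1 ub uw) -xw bx.
have /eqP eqs : [set x | edge b x] == P @: [set x | edge u x].
  rewrite eqEcard sub (leq_trans (leq_imset_card _ _)) //.
  by rewrite -/(undirected_degree u) -/(undirected_degree b) !degG.
have : P a \in P @: [set x | edge u x] by apply: imset_f; rewrite inE.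
by rewrite -eqs inE.
Qed.

(** If u ~ a ~ y -> c with y distinct from u, and u -> b, then [edge_repeat] gives b ~ P a ~ c, a
    second walk from u to c, so c = P u. Two choices of a share this c, hence y as in-degrees are 1,
    against [middle_unique]. *)
Lemma out_degree_not_one u : z = 1 -> 1 < r -> False.
Proof.
move=> z1 r1.
have far a y c : edge u a -> edge a y -> y != u -> arc y c -> c = P u.
  move=> ua ay yu yc; have [b ub] := out_arc u.
  have bP := edge_repeat z1 r1 ua ub.
  have cP : edge c (P a) by apply: (edge_repeat z1 r1 _ yc); rewrite edge_sym.
  apply: (@repeatP u c (inr (inr (b, P a))) (inr (inr (a, y)))) => /=.
  - rewrite arc_step // edge_step // edge_step ?(edge_sym _ c) // (arc_edge_neq ub bP) /=.
    by apply: contraNneq yu => bc; rewrite -bc in yc; rewrite (arc_unique_l z1 ub yc).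
  - by rewrite (edge_step ua) (edge_step ay) (arc_step yc) eq_sym yu (edge_arc_neq ay yc).
  - by apply: contraTneq ub => -[-> _]; apply: edge_not_arc.
have [a ua _] := other_edge u u r1; have [b ub ba] := other_edge u a r1.
have [x ax xu] := other_edge a u r1; have [y by_ yu] := other_edge b u r1.
have [c xc] := out_arc x; have [e ye] := out_arc y.
have cP := far _ _ _ ua ax xu xc; have eP := far _ _ _ ub by_ yu ye.
rewrite eP -cP in ye; have xy := arc_unique_l z1 xc ye.
case/eqP: ba; rewrite -xy in by_.
by apply: (@middle_unique u x); rewrite ?edge_step // eq_sym.
Qed.

(** * The case r = 1 *)

Lemma edge_unique u a b : r = 1 -> edge u a -> edge u b -> a = b.
Proof.
move=> r1 ua ub; apply/eqP; apply: contraT => ab.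
suff: 1 < undirected_degree u by rewrite degG r1.
by apply/card_gt1P; exists a, b; rewrite !inE.
Qed.

Lemma repeat_edge u : r = 1 -> edge u (P u).
Proof.
move=> r1; apply: contraT => nP.
have z_gt1 : 1 < z by move: rz_gt1; rewrite r1 mul1n.
have [a ua] := out_edge u.
have aP : a != P u by apply: contraNneq nP => <-.
have uP : u != P u.
  apply/negP => uP; have [|x []] := @repeat_far u (inl false) nP; first by [].
  by [].
have shared y : arc a y -> arc (P u) y.
  move=> ay; case/step_split: (edge_arc_repeat ua ay) => // Py.
  (* If P u ~ y, another arc a -> w yields P u -> w, and a -> y ~ P u -> w makes w the repeat of a
     although a -> w. *)
  have [w aw wy] : exists2 w, arc a w & w != y.
    have [w [x [aw ax wx]]] := two_arcs a z_gt1.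
    have [e|] := eqVneq w y; last by exists w.
    by exists x; rewrite // -e eq_sym.
  have Pw : arc (P u) w.
    case/step_split: (edge_arc_repeat ua aw) => // Pw.
    by case/eqP: wy; exact: edge_unique Pw Py.
  have wP : w = P a.
    apply: (@repeatP a w (inr (inr (y, P u))) (inl true)) => //=.
      by rewrite (arc_step ay) edge_step 1?edge_sym // (arc_step Pw) aP eq_sym wy.
    exact: arc_step.
  have [||x []] // := @repeat_far a (inl true).
    by rewrite -wP arc_not_edge.
  by rewrite /= -wP arc_step.
have [y [w [ay aw yw]]] := two_arcs a z_gt1.
have [[[]|[x|[x x']]] /=] := reach a (P u).
- case/step_split => [aPu|aPu].
    have e : P u = u by apply: (edge_unique r1 aPu); rewrite edge_sym.
    by rewrite e eqxx in uP.
  by have := arc_neq (shared _ aPu); rewrite eqxx.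
- by rewrite (negbTE aP).
(* Length 2: extending the walk along arcs that [P u] shares with [a] makes both [y] and [w] the
   repeat of [a]. *)
- case/and3P => ax xP _.
  have rep v : arc a v -> v = P a.
    move=> av; apply: (@repeatP a v (inr (inr (x, P u))) (inl true)) => //=.
      by rewrite ax xP arc_step ?shared // aP (step_neq_arc xP (shared _ av)).
    exact: arc_step.
  by rewrite (rep y) // (rep w) // eqxx in yw.
(* Length 3: a first step along an edge leads to [u], leaving a walk of length 2 from [u] to [P u],
   against [repeat_far]. *)
case/and5P => ax xx' x'P ax' xP; case/step_split: ax => ax.
  have xu : x = u by apply: (edge_unique r1 ax); rewrite edge_sym.
  have [|x0 []] // := @repeat_far u (inr (inl x')) nP.
  by rewrite /= -{1}xu xx' x'P uP.
(* A first step along an arc is shared by [P u], which gives a closed walk of length 3 there;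
   injectivity then yields u = P u. *)
have PP : P u = P (P u).
  apply: (@repeatP (P u) (P u) (inr (inr (x, x'))) (inl false)) => //=.
  by rewrite arc_step ?shared // xx' x'P xP eq_sym (step_neq x'P).
by rewrite {1}(repeat_inj PP) eqxx in uP.
Qed.

Lemma degree_one_comp u v : r = 1 ->
  comp stp (comp stp stp) u v + comp stp stp u v = stp u v + 1.
Proof.
move=> r1; have := walks_comp u v degG; rewrite walksP.
have -> : (v == P u) = edge u v.
  apply/eqP/idP => [->|uv]; first exact: repeat_edge.
  exact: edge_unique uv (repeat_edge u r1).
by rewrite r1 -/(edg u v); lia.
Qed.

End InRegular.
End AlmostMoore.

(** * The Moore bound and the spectral argument *)

Import Order.TTheory GRing.Theory Num.Theory.

Section Algebra.
Local Open Scope ring_scope.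

(** In a rank factorization A = C B idempotence forces B C = 1, and swapping the factors preserves
    the trace. *)
Lemma mxtrace_idem (F : fieldType) n (A : 'M[F]_n) :
  A *m A = A -> \tr A = (\rank A)%:R.
Proof.
move=> idA; move: (mulmx_base A) (row_base_free A) (col_base_full A).
move: (col_base A) (row_base A) => C B eA freeB fullC.
suff id1 : B *m C = 1%:M by rewrite -{1}eA mxtrace_mulC id1 mxtrace1.
apply: (row_full_inj fullC); apply: (row_free_inj freeB).
by rewrite /= mulmx1 !mulmxA eA -mulmxA eA idA.
Qed.

(** For nonzero q the exponent of 5 is odd on the left and even on the right. *)
Lemma five_sq_neq (t q : int) : 5 * t ^+ 2 = q ^+ 2 -> q = 0.
Proof.
move=> /(congr1 absz); rewrite abszM !abszX => e.
apply/eqP; rewrite -absz_eq0 -leqn0 leqNgt; apply/negP => q0.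
have t0 : (0 < `|t|)%N.
  by rewrite lt0n; apply: contraTneq q0 => t0; move: e; rewrite t0; case: `|q|%N.
have /(congr1 (fun n => odd (logn 5 n))) := e.
by rewrite lognM ?expn_gt0 ?t0 // !lognX !mul2n /= !odd_double.
Qed.

(* On the complement of the all-one vector, N is diagonalizable with
   eigenvalues 0 and (-1 +- sqrt 5) / 2; a spectral projection has trace
   (d^3 - 2 d + (d^3 - 4 d) / sqrt 5) / 2, which is no integer for d > 2. *)
Lemma no_golden_matrix (R : rcfType) m (N : 'M[R]_m) (d : nat) :
  N *m (N *m N) + N *m N = N + const_mx 1 ->
  N *m const_mx 1 = const_mx d%:R :> 'M_m ->
  const_mx 1 *m N = const_mx d%:R :> 'M_m ->
  \tr N = 0 -> \tr (N *m N) = m%:R ->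
  (m + 2 * d = d + d ^ 2 + d ^ 3)%N -> (2 < d)%N -> False.
Proof.
move=> eN3 eNJ eJN tr1 tr2 card d2.
set J : 'M[R]_m := const_mx 1 in eN3 eNJ eJN.
have eJ : const_mx d%:R = d%:R *: J :> 'M_m by apply/matrixP => i j; rewrite !mxE mulr1.
rewrite eJ in eNJ eJN; set N2 := N *m N in eN3 tr2.
have eN3' : N *m N2 = N + J - N2 by rewrite -eN3 addrK.
have eN3r : N2 *m N = N + J - N2 by rewrite /N2 -mulmxA.
have eN4 : N2 *m N2 = 2%:R *: N2 - N + (d%:R - 1) *: J.
  rewrite {1}/N2 -mulmxA eN3' !mulmxDr mulmxN eN3' eNJ -/N2.
  by apply/matrixP => i j; rewrite !mxE; ring.
have eN2J : N2 *m J = d%:R ^+ 2 *: J.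
  by rewrite /N2 -mulmxA eNJ -scalemxAr eNJ scalerA.
have eJN2 : J *m N2 = d%:R ^+ 2 *: J.
  by rewrite /N2 mulmxA eJN -scalemxAl eJN scalerA.
have eJJ : J *m J = m%:R *: J.
  apply/matrixP => i j; rewrite !mxE mulr1.
  under eq_bigr do rewrite !mxE mulr1.
  by rewrite sumr_const card_ord.
have trJ : \tr J = m%:R.
  by rewrite /mxtrace; under eq_bigr do rewrite mxE; rewrite sumr_const card_ord.
have eM : m%:R = d%:R * (d%:R ^+ 2 + d%:R - 1) :> R.
  have /(congr1 (fun k => k%:R : R)) := card.
  by rewrite !natrD !natrX => e; apply: (addIr (d%:R + (d%:R + 0))); rewrite e; ring.
have d_gt2 : (2 : R) < d%:R by rewrite ltr_nat.
set D : R := d%:R in eNJ eJN eN4 eN2J eJN2 eM d_gt2.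
have c0 : D ^+ 2 + D - 1 != 0 by nra.
(* [t] is 1 / sqrt 5. The polynomial a x^2 + b x is 1 at (-1 + sqrt 5) / 2 and 0 at the other two
   eigenvalues; [c] makes [F] annihilate the all-one vector. *)
pose t : R := Num.sqrt 5 / 5.
have t2 : t ^+ 2 = 5^-1 by rewrite expr_div_n sqr_sqrtr ?ler0n //; field.
pose h : R := (D + 1) / (D ^+ 2 + D - 1).
pose a : R := (1 + t) / 2; pose b : R := (1 + 3 * t) / 2.
pose c : R := (- h + (2 - 2 * h * D - h) * t) / 2.
pose F := a *: N2 + b *: N + c *: J.
have idF : F *m F = F.
  rewrite /F !mulmxDl !mulmxDr -!scalemxAl -!scalemxAr.
  rewrite eN4 eN3r eN2J eN3' -/N2 eNJ eJN2 eJN eJJ eM.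
  have e1 : 2 * a ^+ 2 - 2 * a * b + b ^+ 2 = a by rewrite /a /b; lra.
  have e2 : - a ^+ 2 + 2 * a * b = b by rewrite /a /b; lra.
  have e3 : a ^+ 2 * (D - 1) + 2 * a * b + 2 * c * (a * D ^+ 2 + b * D)
      + c ^+ 2 * (D * (D ^+ 2 + D - 1)) = c.
    pose g := 2 - 2 * h * D - h.
    pose q := (D - 1) / 4 + 3 / 2 + g * (D ^+ 2 + 3 * D) / 2
      + g ^+ 2 * (D * (D ^+ 2 + D - 1)) / 4.
    apply/eqP; rewrite -subr_eq0; apply/eqP.
    transitivity ((t ^+ 2 - 5^-1) * q); last by rewrite t2 subrr mul0r.
    by rewrite /q /g /c /h /a /b; field; exact: c0.
  apply/matrixP => i j; rewrite !mxE.
  move: (\sum_j0 _) (N i j) => x y.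
  transitivity ((2 * a ^+ 2 - 2 * a * b + b ^+ 2) * x
    + (- a ^+ 2 + 2 * a * b) * y + (a ^+ 2 * (D - 1) + 2 * a * b
    + 2 * c * (a * D ^+ 2 + b * D) + c ^+ 2 * (D * (D ^+ 2 + D - 1)))).
    by ring.
  by rewrite e1 e2 e3 mulr1.
have trF : \tr F = (D ^+ 3 - 2 * D + (D ^+ 3 - 4 * D) * t) / 2.
  rewrite /F !mxtraceD !mxtraceZ tr1 tr2 trJ eM /a /b /c /h.
  by field.
have := mxtrace_idem idF; rewrite trF; set k := \rank F => ek.
(* The trace formula says 2 k - d^3 + 2 d = (d^3 - 4 d) / sqrt 5; squaring gives an equation in
   integers. *)
have : 5 * (2 * k%:Z - d%:Z ^+ 3 + 2 * d%:Z) ^+ 2 = (d%:Z ^+ 3 - 4 * d%:Z) ^+ 2.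
  apply: (@intr_inj R).
  rewrite !(rmorphM, rmorphB, rmorphD, rmorphXn) /= -!pmulrn -/D -ek.
  rewrite [X in _ * X ^+ 2](_ : _ = (D ^+ 3 - 4 * D) * t); last by field.
  by rewrite exprMn t2; field.
move=> /five_sq_neq.
have: (d%:Z ^+ 3 - 4 * d%:Z = d%:Z * (d%:Z - 2) * (d%:Z + 2)) by ring.
move=> -> /eqP; rewrite !mulf_eq0; lia.
Qed.

Lemma moore_bound3 (R : rcfType) r z : (0 < r)%N -> (0 < z)%N ->
  moore_bound R r z 3 + 2 * r%:R * (r + z)%:R =
  1 + (r + z)%:R + (r + z)%:R ^+ 2 + (r + z)%:R ^+ 3.
Proof.
move=> r0 z0; rewrite /moore_bound /moore_A /moore_B.
have geo (x : R) : x != 1 -> (x ^+ 4 - 1) / (x - 1) = 1 + x + x ^+ 2 + x ^+ 3.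
  by move=> x1; field; rewrite subr_eq0.
have hr : (1 : R) <= r%:R by rewrite ler1n.
have hz : (1 : R) <= z%:R by rewrite ler1n.
have w0 : 0 < moore_w R r z by rewrite /moore_w; nra.
have s2 : Num.sqrt (moore_w R r z) ^+ 2 = moore_w R r z by rewrite sqr_sqrtr ?ltW.
have s0 : Num.sqrt (moore_w R r z) != 0 by rewrite gt_eqF ?sqrtr_gt0.
(* This product is negative, so neither root is 1 and the geometric sums expand. *)
have u12 : (moore_u1 R r z - 1) * (moore_u2 R r z - 1) = 2 - r%:R - 2 * z%:R.
  move: s2; rewrite /moore_u1 /moore_u2; move: (Num.sqrt _) => s; rewrite /moore_w => s2.
  transitivity (((z%:R + r%:R - 3) ^+ 2 - s ^+ 2) / 4); first by field.
  by rewrite s2; field.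
have : (moore_u1 R r z - 1) * (moore_u2 R r z - 1) != 0 by rewrite u12; apply/eqP; lra.
rewrite mulf_eq0 !subr_eq0 negb_or => /andP[u1 u2].
rewrite !geo // /moore_u1 /moore_u2.
move: s2 s0; move: (Num.sqrt _) => s; rewrite /moore_w natrD.
set D := r%:R + z%:R => s2 s0.
(* Eliminating z and r through s^2 = (D + 1)^2 - 4 r leaves a rational identity in D and s. *)
have -> : z%:R = D - r%:R by rewrite /D; ring.
have -> : r%:R = ((D + 1) ^+ 2 - s ^+ 2) / 4 by rewrite s2 /D; field.
by field.
Qed.

Lemma bigmax_gt0_inhabited (T : finType) (F : T -> nat) k : (0 < k)%N ->
  (\max_(x : T) F x)%N = k -> exists x : T, True.
Proof.
move=> k0 mx; case: (pickP (fun _ : T => true)) => [x _|none]; first by exists x.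
by move: mx k0; rewrite big_pred0 // => <-.
Qed.

End Algebra.

Theorem theorem4p5 (R : rcfType) (r z : nat) (hr : 1 <= r) (hz : 1 <= z)
    (hrz : 1 < r \/ 1 < z) :
  ~ exists G : mixedGraph, is_rzk_graph R r z 3 1 G.
Proof.
case=> G [diamG degG outG cardR].
have deg_le (u : G) : undirected_degree u <= r by rewrite -degG; apply: leq_bigmax.
have out_le (u : G) : out_degree u <= z by rewrite -outG; apply: leq_bigmax.
have [u _] := bigmax_gt0_inhabited hr degG.
have cardG : #|G| + 2 * r * (r + z) = (r + z) + (r + z) ^ 2 + (r + z) ^ 3.
  have := @moore_bound3 R r z hr hz.
  have -> : moore_bound R r z 3 = ((#|G|%:R : R) + 1)%R by rewrite cardR subrK.
  move=> e; apply/eqP; rewrite -(eqr_nat R) natrD 2!natrM.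
  rewrite [X in _ == X]natrD [X in _ == (X + _)%R]natrD !natrX; apply/eqP.
  apply: (@addrI R 1%R); move: e; rewrite -mulrA.
  by move: (r%:R * _)%R (_ ^+ 2)%R (_ ^+ 3)%R => a b c e; lra.
have regG := out_regular hr hz diamG deg_le out_le cardG.
have deg (w : G) : undirected_degree w = r by have [] := regG w.
have out (w : G) : out_degree w = z by have [] := regG w.
pose P w := sval (repeat_exists hr hz diamG deg_le out_le cardG w).
have walksP (w v : G) : walks w v = 1 + (v == P w).
  exact: (svalP (repeat_exists hr hz diamG deg_le out_le cardG w)).
have rz_gt1 : 1 < r * z.
  by case: hrz => h; [have := leq_mul h hz | have := leq_mul hr h]; lia.
have [r_le1|r_gt1] := leqP r 1; last first.
  have := prod_le_sum hr hz deg out walksP rz_gt1 cardG u.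
  have [z_le1|z_gt1] := leqP z 1.
    move=> _; apply: (out_degree_not_one hr hz deg out walksP rz_gt1 cardG u) => //.
    by apply/eqP; rewrite eqn_leq z_le1.
  move=> le; apply: (prod_degrees_neq_sum hr hz deg out walksP rz_gt1 cardG u r_gt1).
  (* For r, z >= 2 the product is at least the sum. *)
  nia.
have r1 : r = 1 by apply/eqP; rewrite eqn_leq r_le1.
pose N : 'M[R]_#|G| :=
  (\matrix_(i, j) (stp (enum_val i) (enum_val j))%:R)%R.
have sumE (F : G -> nat) : (\sum_(i < #|G|) (F (enum_val i))%:R = (\sum_x F x)%:R :> R)%R.
  by rewrite natr_sum (reindex (@enum_val G G)) //; apply: onW_bij; exact: enum_val_bij.
have NN i j : ((N *m N) i j = (comp stp stp (enum_val i) (enum_val j))%:R)%R.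
  rewrite !mxE -sumE; apply: eq_bigr => k _.
  by rewrite !mxE natrM.
have inG := in_regular hr hz deg out walksP rz_gt1 cardG.
apply: (@no_golden_matrix R #|G| N (r + z)).
- apply/matrixP => i j; rewrite !mxE.
  have := degree_one_comp hr hz deg out walksP rz_gt1 cardG (enum_val i) (enum_val j) r1.
  move=> /(congr1 (fun k => k%:R : R)%R); rewrite !natrD => <-; congr (_ + _)%R.
    rewrite -sumE; apply: eq_bigr => k _.
    by rewrite NN natrM mxE.
  by rewrite -NN mxE.
- apply/matrixP => i j; rewrite !mxE.
  under eq_bigr do rewrite !mxE mulr1.
  by rewrite (sumE (stp (enum_val i))) sum_stp deg out.
- apply/matrixP => i j; rewrite !mxE.
  under eq_bigr do rewrite !mxE mul1r.
  by rewrite (sumE (stp^~ (enum_val j))) (sum_stpl deg) inG.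
- apply: big1 => i _; rewrite mxE /stp.
  by case e: (step _ _) => //; have := step_neq e; rewrite eqxx.
- rewrite /mxtrace; under eq_bigr do rewrite NN.
  rewrite (sumE (fun x => comp stp stp x x)); congr (_%:R)%R.
  rewrite -[RHS]muln1 -sum_const; apply: eq_bigr => x _.
  by rewrite /comp; under eq_bigr do rewrite stp_stp; rewrite sum_edg deg.
- by have := cardG; rewrite {1}r1 muln1.
- by case: hrz; lia.
Qed.
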